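(* Let $X$ be a compact, connected complex manifold and let $\Gamma$ be a holomorphic correspondence on $X$. For $\varepsilon>0$ and $\nu\in\mathbb{Z}_+$, let $N(\varepsilon,\nu)$ be the greatest possible cardinality of an $(\varepsilon,\nu)$-separated family of $\nu$-orbits of $\Gamma$. Let $\mathscr{S}$ denote the restriction of the shift map $$(x_0,x_1,x_2,\dots;\alpha_1,\alpha_2,\dots)\mapsto(x_1,x_2,x_3,\dots;\alpha_2,\alpha_3,\dots)$$ to the space ${}^{\Gamma}X$ of infinite orbits of $\Gamma$. Then $$h_{top}(\Gamma):=\sup_{\varepsilon>0}\limsup_{\nu\to\infty}\frac1\nu\log N(\varepsilon,\nu)=h(\mathscr{S}),$$ where $h(\mathscr{S})$ is the topological entropy, in the sense of Bowen, of the continuous map $\mathscr{S}:{}^{\Gamma}X\to{}^{\Gamma}X$.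
   Context: $\mathbb{N}=\{0,1,2,\dots\}$, $\mathbb{Z}_+=\{1,2,\dots\}$. **Holomorphic correspondence.** Let $X$ have dimension $n$. A holomorphic correspondence on $X$ is a formal sum $\Gamma=\sum_{j=1}^N m_j\Gamma_j$, where the $m_j$ are positive integers and $\Gamma_1,\dots,\Gamma_N$ are distinct irreducible complex-analytic subvarieties of $X\times X$ of pure dimension $n$ such that, for each $j$, both projections $\pi_1|_{\Gamma_j},\pi_2|_{\Gamma_j}:\Gamma_j\to X$ are surjective and have finite fibres. Repeating each $\Gamma_j$ exactly $m_j$ times, list the components as $\Gamma^\bullet_1,\dots,\Gamma^\bullet_M$ (not necessarily distinct), with $M=m_1+\dots+m_N$. **Finite orbits and separation.** A $\nu$-orbit of $\Gamma$ is a tuple $(x_0,\dots,x_\nu;\alpha_1,\dots,\alpha_\nu)\in X^{\nu+1}\times\{1,\dots,M\}^\nu$ with $(x_{j-1},x_j)\in\Gamma^\bullet_{\alpha_j}$ for $j=1,\dots,\nu$. Fix a metric $d$ compatible with the topology of $X$ (the entropy $h_{top}(\Gamma)$ does not depend on it). A family of $\nu$-orbits is $(\varepsilon,\nu)$-separated if for any two distinct elements $(x_0,\dots,x_\nu;\alpha_1,\dots,\alpha_\nu)$ and $(y_0,\dots,y_\nu;\beta_1,\dots,\beta_\nu)$ of it, either $d(x_j,y_j)>\varepsilon$ for some $0\le j\le\nu$ or $\alpha_j\ne\beta_j$ for some $1\le j\le\nu$. Such families are finite, by compactness of $X$. **Infinite orbits.** $${}^{\Gamma}X:=\{(x_0,x_1,\dots;\alpha_1,\alpha_2,\dots)\in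 X^{\mathbb{N}}\times\{1,\dots,M\}^{\mathbb{Z}_+}:(x_{\nu-1},x_\nu)\in\Gamma^\bullet_{\alpha_\nu}\ \forall\nu\in\mathbb{Z}_+\},$$ with the topology inherited from the product topology on $X^{\mathbb{N}}\times\{1,\dots,M\}^{\mathbb{Z}_+}$ (a compact metrisable space). **Bowen entropy.** For a compact metric space $(Y,D)$ and continuous $f:Y\to Y$, let $M(\varepsilon,n)$ be the greatest cardinality of a set of orbits $(x_0,f(x_0),\dots,f^n(x_0))$ such that any two distinct ones $(x_j)$, $(y_j)$ satisfy $D(x_j,y_j)>\varepsilon$ for some $0\le j\le n$. Then $h(f):=\sup_{\varepsilon>0}\limsup_{n\to\infty}\frac1n\log M(\varepsilon,n)$, which is independent of the metric inducing the topology of $Y$. *)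

(* Defs.v *)
From HB Require Import structures.
From mathcomp Require Import all_boot all_order all_algebra.
From mathcomp Require Import complex.
From mathcomp Require Import all_classical all_reals all_analysis.

Set Implicit Arguments.
Unset Strict Implicit.
Unset Printing Implicit Defensive.

Import Order.TTheory GRing.Theory Num.Theory.
Import numFieldNormedType.Exports.

Local Open Scope classical_set_scope.
Local Open Scope ring_scope.

(* The norm topology is declared on numClosedFieldType structures and is not
   inferred on the bare type R[i]. *)
Definition complexField (R : realType) : numClosedFieldType := R[i].

(* [chart_inv] is the inverse of [chart_map] on the image of [chart_dom]; both
   functions are unconstrained elsewhere. *)
Record chart (R : realType) (X : topologicalType) (n : nat) := Chart {
  chart_dom : set X;
  chart_map : X -> 'rV[complexField R]_n;
  chart_inv : 'rV[complexField R]_n -> X;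
  chart_dom_open : open chart_dom;
  chart_img_open : open (chart_map @` chart_dom);
  chart_mapK : {in chart_dom, cancel chart_map chart_inv};
  chart_map_continuous : {in chart_dom, continuous chart_map};
  chart_inv_continuous : {in chart_map @` chart_dom, continuous chart_inv} }.

(* A map between open subsets of complex vector spaces is holomorphic when it
   is Frechet differentiable over R[i] at every point. *)
Definition holomorphic_transition (R : realType) (X : topologicalType) (n : nat)
    (c c' : chart R X n) : Prop :=
  forall x, chart_dom c x -> chart_dom c' x ->
    differentiable (chart_map c' \o chart_inv c) (chart_map c x).

Definition compatible_charts (R : realType) (X : topologicalType) (n : nat)
    (c c' : chart R X n) : Prop :=
  holomorphic_transition c c' /\ holomorphic_transition c' c.

Record complexManifold (R : realType) (n : nat) := ComplexManifold {
  manifold_carrier :> topologicalType;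
  manifold_atlas : set (chart R manifold_carrier n);
  manifold_hausdorff : hausdorff_space manifold_carrier;
  manifold_cover : forall x, exists2 c, manifold_atlas c & chart_dom c x;
  manifold_compat : forall c c', manifold_atlas c -> manifold_atlas c' ->
    compatible_charts c c' }.

Arguments manifold_atlas {R n} M _ : rename.

Lemma cvg_row_mx (K : numFieldType) (T : Type) (F : set_system T)
    (FF : Filter F) (m n : nat) (f : T -> 'rV[K]_m) (g : T -> 'rV[K]_n)
    (a : 'rV[K]_m) (b : 'rV[K]_n) :
  f @ F --> a -> g @ F --> b ->
  (fun x => row_mx (f x) (g x) : 'rV[K]_(m + n)) @ F -->
    (row_mx a b : 'rV[K]_(m + n)).
Proof.
move=> fa gb; apply/cvg_ballP => e e0.
move/cvg_ballP: fa => /(_ _ e0) fa; move/cvg_ballP: gb => /(_ _ e0) gb.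
near=> x.
have [_ Ha] : ball a e (f x) by near: x.
have [_ Hb] : ball b e (g x) by near: x.
split=> // i j; rewrite !mxE.
by case: (fintype.split j).
Unshelve. all: by end_near. Qed.

Lemma differentiable_row_mx (K : numFieldType) (V : normedModType K) (m n : nat)
    (f : V -> 'rV[K]_m) (g : V -> 'rV[K]_n) x :
  differentiable f x -> differentiable g x ->
  differentiable (fun v => row_mx (f v) (g v)) x.
Proof.
move=> fx gx.
pose L (u : 'rV[K]_m) : 'rV[K]_(m + n) := row_mx u 0.
pose L' (u : 'rV[K]_n) : 'rV[K]_(m + n) := row_mx 0 u.
have linL : linear L.
  by move=> k u v; rewrite /L scale_row_mx add_row_mx scaler0 addr0.
have linL' : linear L'.
  by move=> k u v; rewrite /L' scale_row_mx add_row_mx scaler0 addr0.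
pose LL := GRing.isLinear.Build K _ _ _ L linL.
pose LL' := GRing.isLinear.Build K _ _ _ L' linL'.
pose fL : {linear 'rV[K]_m -> 'rV[K]_(m + n)} := HB.pack L LL.
pose fL' : {linear 'rV[K]_n -> 'rV[K]_(m + n)} := HB.pack L' LL'.
have -> : (fun v => row_mx (f v) (g v)) = (fL \o f) \+ (fL' \o g).
  by apply/funext => v; rewrite /= /L /L' add_row_mx addr0 add0r.
apply: differentiableD; apply: differentiable_comp => //.
- apply: linear_differentiable => u.
  by apply: (@cvg_row_mx K _ (nbhs u) _ m n id (fun=> 0));
    [exact: cvg_id|exact: cvg_cst].
- apply: linear_differentiable => u.
  by apply: (@cvg_row_mx K _ (nbhs u) _ m n (fun=> 0) id);
    [exact: cvg_cst|exact: cvg_id].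
Qed.

Section ProductManifold.
Variable R : realType.

Section ProductChart.
Variables (X Y : topologicalType) (m n : nat).
Variables (c : chart R X m) (c' : chart R Y n).

Let dom := chart_dom c `*` chart_dom c'.
Let map (p : X * Y) : 'rV[complexField R]_(m + n) :=
  row_mx (chart_map c p.1) (chart_map c' p.2).
Let inv (v : 'rV[complexField R]_(m + n)) : X * Y :=
  (chart_inv c (lsubmx v), chart_inv c' (rsubmx v)).

Let dom_open : open dom.
Proof.
rewrite openE => -[x y] [/= xc yc].
exists (chart_dom c, chart_dom c') => //=.
by split; apply: open_nbhs_nbhs; split=> //; exact: chart_dom_open.
Qed.

Let img_open : open (map @` dom).
Proof.
have -> : map @` dom = (lsubmx @^-1` (chart_map c @` chart_dom c)) `&`
    (rsubmx @^-1` (chart_map c' @` chart_dom c')).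
  apply/seteqP; split=> [v [p [p1 p2] <-]|v [[x xc xv] [y yc yv]]].
    by split; rewrite /map /= ?row_mxKl ?row_mxKr; [exists p.1|exists p.2].
  by exists (x, y) => //; rewrite /map /= xv yv hsubmxK.
apply: openI; apply: open_comp; try exact: chart_img_open.
- move=> v _; exact: continuous_lsubmx.
- move=> v _; exact: continuous_rsubmx.
Qed.

Let mapK : {in dom, cancel map inv}.
Proof.
move=> [x y] /set_mem[/= xc yc]; rewrite /map /inv row_mxKl row_mxKr.
by rewrite !chart_mapK ?inE.
Qed.

Let map_continuous : {in dom, continuous map}.
Proof.
move=> p /set_mem[pc pc']; apply: cvg_row_mx.
- apply: (continuous_comp (f := fst)); first exact: cvg_fst.
  by apply: chart_map_continuous; rewrite inE.
- apply: (continuous_comp (f := snd)); first exact: cvg_snd.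
  by apply: chart_map_continuous; rewrite inE.
Qed.

Let inv_continuous : {in map @` dom, continuous inv}.
Proof.
move=> _ /set_mem[p [pc pc'] <-].
apply: (cvg_pair (F := nbhs (map p)) (f := chart_inv c \o lsubmx)
  (g := chart_inv c' \o rsubmx)).
- apply: (@continuous_comp _ _ _ lsubmx (chart_inv c)).
    exact: continuous_lsubmx.
  apply: chart_inv_continuous; rewrite inE /map row_mxKl.
  by exists p.1.
- apply: (@continuous_comp _ _ _ rsubmx (chart_inv c')).
    exact: continuous_rsubmx.
  apply: chart_inv_continuous; rewrite inE /map row_mxKr.
  by exists p.2.
Qed.

Definition prod_chart : chart R (X * Y)%type (m + n) :=
  Chart dom_open img_open mapK map_continuous inv_continuous.

End ProductChart.

Lemma prod_transition (X Y : topologicalType) (m n : nat) (a b : chart R X m)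
    (a' b' : chart R Y n) :
  holomorphic_transition a b -> holomorphic_transition a' b' ->
  holomorphic_transition (prod_chart a a') (prod_chart b b').
Proof.
move=> ab ab' p [pa pa'] [pb pb'].
apply: (differentiable_row_mx (f := (chart_map b \o chart_inv a) \o lsubmx)
  (g := (chart_map b' \o chart_inv a') \o rsubmx)).
- apply: differentiable_comp; first exact: differentiable_lsubmx.
  by rewrite row_mxKl; exact: ab.
- apply: differentiable_comp; first exact: differentiable_rsubmx.
  by rewrite row_mxKr; exact: ab'.
Qed.

Section ProductAtlas.
Variables (m n : nat) (X : complexManifold R m) (Y : complexManifold R n).

Definition prod_atlas : set (chart R (X * Y)%type (m + n)) :=
  [set prod_chart c c' | c in manifold_atlas X & c' in manifold_atlas Y].

Let prod_hausdorff : hausdorff_space (X * Y)%type.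
Proof.
move=> [x y] [x' y'] pq; congr pair.
- apply: (@manifold_hausdorff _ _ X) => A B Ax Bx'.
  have [||[u v] [Au Bu]] := pq (A `*` setT) (B `*` setT).
  + by exists (A, setT) => //; split=> //; exact: filterT.
  + by exists (B, setT) => //; split=> //; exact: filterT.
  by exists u; split; [case: Au|case: Bu].
- apply: (@manifold_hausdorff _ _ Y) => A B Ay By'.
  have [||[u v] [Av Bv]] := pq (setT `*` A) (setT `*` B).
  + by exists (setT, A) => //; split=> //; exact: filterT.
  + by exists (setT, B) => //; split=> //; exact: filterT.
  by exists v; split; [case: Av|case: Bv].
Qed.

Let prod_cover p : exists2 c, prod_atlas c & chart_dom c p.
Proof.
have [c Xc cp] := manifold_cover p.1; have [c' Yc' cp'] := manifold_cover p.2.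
by exists (prod_chart c c') => //; exists c => //; exists c'.
Qed.

Let prod_compat c c' : prod_atlas c -> prod_atlas c' -> compatible_charts c c'.
Proof.
move=> [a Xa [a' Ya' <-]] [b Xb [b' Yb' <-]].
have [ab ba] := manifold_compat Xa Xb.
have [ab' ba'] := manifold_compat Ya' Yb'.
by split; exact: prod_transition.
Qed.

Definition prod_manifold : complexManifold R (m + n) :=
  ComplexManifold prod_hausdorff prod_cover prod_compat.

End ProductAtlas.
End ProductManifold.

Section AnalyticSubsets.
Variables (R : realType) (n : nat) (M : complexManifold R n).

Definition holomorphic_on (W : set M) (f : M -> complexField R) : Prop :=
  forall c x, manifold_atlas M c -> W x -> chart_dom c x ->
    differentiable (f \o chart_inv c) (chart_map c x).

(* The point p ranges over all of M, so an analytic subset is closed. *)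
Definition analytic_subset (Z : set M) : Prop :=
  forall p : M, exists (W : set M) (k : nat) (f : 'I_k -> M -> complexField R),
    [/\ open_nbhs p W, forall i, holomorphic_on W (f i) &
        W `&` Z = W `&` [set x | forall i, f i x = 0]].

Definition irreducible_analytic (Z : set M) : Prop :=
  [/\ analytic_subset Z, Z !=set0 &
      forall Z1 Z2 : set M, analytic_subset Z1 -> analytic_subset Z2 ->
        Z = Z1 `|` Z2 -> Z = Z1 \/ Z = Z2].

(* Near p, the set Z is a k-dimensional complex submanifold: in a holomorphic
   chart it is the coordinate subspace of the first k coordinates. *)
Definition regular_point (Z : set M) (k : nat) (p : M) : Prop :=
  [/\ (k <= n)%N, Z p & exists c : chart R M n,
      [/\ forall c', manifold_atlas M c' -> compatible_charts c c',
          chart_dom c p &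
          forall x, chart_dom c x ->
            (Z x <-> forall i : 'I_n, (k <= i)%N -> chart_map c x 0 i = 0)]].

(* dim_p Z = d, where dim_p Z is the limsup of dim_q Z over the regular points
   q of Z tending to p. *)
Definition dim_at (Z : set M) (p : M) (d : nat) : Prop :=
  (\forall q \near p, forall k, regular_point Z k q -> (k <= d)%N) /\
  (forall W, nbhs p W -> exists2 q, W q & regular_point Z d q).

Definition pure_dim (Z : set M) (d : nat) : Prop :=
  forall p, Z p -> dim_at Z p d.

End AnalyticSubsets.

(* The formal sum of the m_j Gamma_j, for j < N. *)
Record holomorphic_correspondence (R : realType) (n : nat)
    (X : complexManifold R n) := HolomorphicCorrespondence {
  corr_size : nat;
  corr_mult : 'I_corr_size -> nat;
  corr_comp : 'I_corr_size -> set (prod_manifold X X);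
  corr_size_gt0 : (0 < corr_size)%N;
  corr_mult_gt0 : forall j, (0 < corr_mult j)%N;
  corr_comp_inj : injective corr_comp;
  corr_irreducible : forall j, irreducible_analytic (corr_comp j);
  corr_pure_dim : forall j, pure_dim (corr_comp j) n;
  corr_fst_surj : forall j, fst @` corr_comp j = [set: X];
  corr_snd_surj : forall j, snd @` corr_comp j = [set: X];
  corr_fst_finite : forall j x, finite_set (corr_comp j `&` fst @^-1` [set x]);
  corr_snd_finite : forall j x, finite_set (corr_comp j `&` snd @^-1` [set x])
}.

Arguments corr_mult {R n X} G _ : rename.
Arguments corr_comp {R n X} G _ _ : rename.

Record compatible_metric (R : realType) (T : topologicalType)
    (d : T -> T -> R) : Prop := CompatibleMetric {
  metric_eq0 : forall x y, d x y = 0 <-> x = y;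
  metric_symm : forall x y, d x y = d y x;
  metric_triangle_ineq : forall x y z, d x z <= d x y + d y z;
  metric_nbhs : forall x (A : set T),
    nbhs x A <-> exists2 e, 0 < e & [set y | d x y < e] `<=` A }.

(* The greatest cardinality of a subset of S, any two distinct elements of which
   are related by sep; +oo if there are infinite or arbitrarily large ones,
   otherwise the supremum is attained. *)
Definition max_separated (R : realType) (T : choiceType) (S : set T)
    (sep : T -> T -> Prop) : \bar R :=
  ereal_sup [set counting F | F in [set F : set T |
    F `<=` S /\ forall x y, F x -> F y -> x <> y -> sep x y]].

(* lne 0 = -oo; the junk term at k = 0 does not affect the limsup. *)
Definition entropy_rate (R : realType) (N : R -> nat -> \bar R) : \bar R :=
  ereal_sup [set limn_esup (fun k => (k%:R^-1)%:E * lne (N e k))%E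
            | e in [set e : R | 0 < e]].

Lemma shift_seq_continuous (T : topologicalType) :
  continuous (fun x : {ptws nat -> T} => (fun k => x k.+1) : {ptws nat -> T}).
Proof.
move=> x; apply/cvg_sup => [|k U [V [[W oW <-] /= Wx] WU]].
  by apply: fmap_filter; exact: (@nbhs_filter {ptws nat -> T}).
have xW : nbhs x [set y : {ptws nat -> T} | W (y k.+1)].
  apply: (@proj_continuous _ (fun _ : nat => T) k.+1 x W).
  exact: open_nbhs_nbhs.
by apply: filterS xW => y Wy; exact: WU.
Qed.

Lemma shift_prod_continuous (T U : topologicalType) :
  continuous (fun o : {ptws nat -> T} * {ptws nat -> U} =>
    (fun k => o.1 k.+1, fun k => o.2 k.+1) : {ptws nat -> T} * {ptws nat -> U}).
Proof.
move=> o; pose s V (x : {ptws nat -> V}) : {ptws nat -> V} := fun k => x k.+1.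
have s1 : (s T \o fst) @ o --> s T o.1.
  apply: (@continuous_comp _ _ _ fst (s T)); first exact: cvg_fst.
  exact: shift_seq_continuous.
have s2 : (s U \o snd) @ o --> s U o.2.
  apply: (@continuous_comp _ _ _ snd (s U)); first exact: cvg_snd.
  exact: shift_seq_continuous.
exact: (cvg_pair s1 s2).
Qed.

Section CorrespondenceEntropy.
Variables (R : realType) (n : nat) (X : complexManifold R n).
Variable G : holomorphic_correspondence X.

(* The list of components with multiplicities is indexed by 'I_corr_total, via
   the bijection [tagnat.sig] from 'I_corr_total to {j & 'I_(corr_mult G j)}. *)
Definition corr_total : nat := (\sum_j corr_mult G j)%N.

Definition corr_listed (a : 'I_corr_total) : set (X * X) :=
  corr_comp G (tagnat.sig1 a).

Local Notation finite_seq nu :=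
  ({ffun 'I_nu.+1 -> X} * {ffun 'I_nu -> 'I_corr_total})%type.
Local Notation infinite_seq :=
  ({ptws nat -> X} * {ptws nat -> discrete_topology 'I_corr_total})%type.

(* The k-th label of an orbit, numbered from 0, is the label of the step from
   the k-th to the (k+1)-st point. *)
Definition finite_orbits (nu : nat) : set (finite_seq nu) :=
  [set o : finite_seq nu | forall k : 'I_nu,
    corr_listed (o.2 k) (o.1 (widen_ord (leqnSn nu) k), o.1 (lift ord0 k))].

Definition orbit_separated (d : X -> X -> R) (e : R) (nu : nat)
    (o o' : finite_seq nu) : Prop :=
  (exists k, e < d (o.1 k) (o'.1 k)) \/ (exists k, o.2 k <> o'.2 k).

Definition corr_entropy (d : X -> X -> R) : \bar R :=
  entropy_rate (fun e nu =>
    max_separated R (@finite_orbits nu) (@orbit_separated d e nu)).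

Definition infinite_orbits : set infinite_seq :=
  [set o : infinite_seq | forall k : nat,
    corr_listed (o.2 k) (o.1 k, o.1 k.+1)].

Definition shift_pair (o : infinite_seq) : infinite_seq :=
  (fun k => o.1 k.+1, fun k => o.2 k.+1).

Lemma shift_pair_orbit o : infinite_orbits o -> infinite_orbits (shift_pair o).
Proof. by move=> oG k; exact: oG. Qed.

Definition shift_fun (o : infinite_orbits) : infinite_orbits :=
  SigSub (mem_set (shift_pair_orbit (set_valP o))).

Lemma shift_fun_continuous : continuous shift_fun.
Proof.
apply: continuous_comp_initial => o.
have val_o : {for o, continuous (set_val : infinite_orbits -> infinite_seq)}.
  exact: initial_continuous.
apply: (@continuous_comp _ _ _ set_val shift_pair o); first exact: val_o.
exact: shift_prod_continuous.
Qed.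

Definition orbit_shift : continuousType infinite_orbits infinite_orbits :=
  mkcts shift_fun_continuous.

End CorrespondenceEntropy.

Arguments infinite_orbits {R n X} G.
Arguments orbit_shift {R n X} G.

Section BowenEntropy.
Variables (R : realType) (Y : topologicalType) (D : Y -> Y -> R).

Definition orbit_segments (f : Y -> Y) (n : nat) : set {ffun 'I_n.+1 -> Y} :=
  [set [ffun j : 'I_n.+1 => iter j f y] | y in [set: Y]].

Definition bowen_separated (e : R) (n : nat)
    (x y : {ffun 'I_n.+1 -> Y}) : Prop :=
  exists j, e < D (x j) (y j).

Definition bowen_entropy (f : continuousType Y Y) : \bar R :=
  entropy_rate (fun e n =>
    max_separated R (@orbit_segments f n) (@bowen_separated e n)).

End BowenEntropy.

(* Main.v *)
(* The orbit space of G is compact: it is closed in a product of copies of X and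
   of the finite label set.  Hence the metric D is uniformly equivalent to
   closeness in d, with equal labels, of finitely many coordinates.
   If two orbits differ at time 0, by more than e in d or by their label, they
   are r-apart in D for some r = r(e); so extending finite orbits to infinite
   ones sends (e, nu)-separated families to r-separated families of segments of
   length nu of the shift.  Conversely D-distance > e is detected by the first
   K = K(e) coordinates, so truncation sends e-separated segments of length nu to
   separated families of (nu + K + 1)-orbits, and the bounded increase in length
   does not affect the exponential growth rate. *)
Require Import Defs.
From mathcomp Require Import all_boot all_order all_algebra.
From mathcomp Require Import all_classical all_reals all_analysis.
Import Order.TTheory GRing.Theory Num.Theory numFieldNormedType.Exports.
Local Open Scope classical_set_scope.
Local Open Scope ring_scope.

Set Implicit Arguments.
Unset Strict Implicit.
Unset Printing Implicit Defensive.

(** * Maximal separated families under maps *)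

Section SeparatedSets.
Variable R : realType.

Lemma counting_image (T U : choiceType) (f : T -> U) (A : set T) :
  {in A &, injective f} -> counting (f @` A) = counting A :> \bar R.
Proof.
move=> f_inj; have fA := inj_card_eq f_inj.
rewrite /counting (eq_finite_set fA); case: asboolP => // finA.
have finfA : finite_set (f @` A) by rewrite (eq_finite_set fA).
by move/(fcard_eq finfA finA): fA => ->.
Qed.

(** Irreflexivity of [sep'] makes [f] injective on each separated family, whose image is then a
    separated family of the same size; [f] may still identify points of [S]. *)
Lemma max_separated_le (T U : choiceType) (S : set T) (S' : set U)
    (sep : T -> T -> Prop) (sep' : U -> U -> Prop) (f : T -> U) :
  (forall x, S x -> S' (f x)) ->
  (forall x y, S x -> S y -> sep x y -> sep' (f x) (f y)) ->
  (forall u, ~ sep' u u) ->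
  (max_separated R S sep <= max_separated R S' sep')%E.
Proof.
move=> fS fsep irr; apply: ge_ereal_sup => _ [F [FS Fsep] <-].
have Fsep' x y : F x -> F y -> x <> y -> sep' (f x) (f y).
  by move=> Fx Fy xy; apply: fsep; [exact: FS|exact: FS|exact: Fsep].
have f_inj : {in F &, injective f}.
  move=> x y /set_mem Fx /set_mem Fy fxy; apply: contrapT => xy.
  by have := Fsep' _ _ Fx Fy xy; rewrite fxy; exact: irr.
rewrite -(counting_image f_inj); apply: ereal_sup_ubound.
exists (f @` F) => //; split=> [_ [x Fx <-]|_ _ [x Fx <-] [y Fy <-] fxy].
  exact/fS/FS.
by apply: Fsep' => // xy; apply: fxy; rewrite xy.
Qed.

(** A singleton is vacuously separated. The bound keeps the logarithms in the growth rates
    nonnegative. *)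
Lemma max_separated_ge1 (T : choiceType) (S : set T) (sep : T -> T -> Prop) x :
  S x -> (1 <= max_separated R S sep)%E.
Proof.
move=> Sx; apply: ereal_sup_ubound; exists [set x].
  by split=> [_ ->|_ _ -> ->].
rewrite /counting; case: asboolP => [_|[]]; last exact: finite_set1.
by rewrite fset_set1 finmap.cardfs1.
Qed.

End SeparatedSets.

(** * Exponential growth rates under a bounded shift of the index *)

Section GrowthRate.
Variable R : realType.
Implicit Types u v : nat -> \bar R.

Lemma limn_esup_lt u (c : \bar R) :
  (limn_esup u < c)%E -> \forall k \near \oo, (u k < c)%E.
Proof.
move=> /ereal_inf_lt[_ [A A_oo <-] Ac]; apply: filterS A_oo => k Ak.
by apply: le_lt_trans Ac; apply: ereal_sup_ubound; exists k.
Qed.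

Lemma limn_esup_le u (c : \bar R) :
  (\forall k \near \oo, (u k <= c)%E) -> (limn_esup u <= c)%E.
Proof.
move=> uc; apply: ge_ereal_inf; exists (ereal_sup (u @` [set k | (u k <= c)%E])).
  by exists [set k | (u k <= c)%E].
by apply: ge_ereal_sup => _ [k uk <-].
Qed.

(** Since [(k + K) / k] tends to 1, dividing by [k] instead of [k + K] does not change a finite
    rate. *)
Lemma limn_esup_rate_shift u v (K : nat) :
  (forall k, 0 <= u k)%E -> (forall k, 1 <= v k)%E ->
  (forall k, u k <= v (k + K)%N)%E ->
  (limn_esup (fun k => (k%:R^-1)%:E * lne (u k)) <=
   limn_esup (fun k => (k%:R^-1)%:E * lne (v k)))%E.
Proof.
move=> u0 v1 uv.
have lv0 k : (0 <= lne (v k))%E by rewrite lne_ge0.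
set b := fun k => ((k%:R^-1)%:E * lne (v k))%E.
have b0 k : (0 <= b k)%E by rewrite mule_ge0// lee_fin invr_ge0.
apply/lee_addgt0Pr => e e0.
have [->|L_oo] := eqVneq (limn_esup b) +oo%E; first by rewrite leey.
have L0 : (0 <= limn_esup b)%E.
  apply: le_ereal_inf_tmp => _ [A [N _ NA] <-].
  apply: le_trans (b0 N) _; apply: ereal_sup_ubound; exists N => //.
  by apply: NA => /=.
have Lfin : limn_esup b \is a fin_num by rewrite ge0_fin_numE// lt_neqAle L_oo leey.
move: L0 Lfin; set L := limn_esup b => L0 Lfin.
pose l := fine L; have lE : L = l%:E by rewrite fineK.
have l0 : 0 <= l by rewrite -lee_fin -lE.
(* Half of [e] turns the limsup into an eventual bound; the other half absorbs the [K] additional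
   steps. *)
pose c := l + e / 2.
have c0 : 0 < c by rewrite /c ltr_wpDl// divr_gt0.
have : (limn_esup b < c%:E)%E by rewrite -/L lE lte_fin /c ltrDl divr_gt0.
move=> /limn_esup_lt[N _ Nb].
apply: limn_esup_le.
near=> k.
have k0 : (0 : R) < k%:R by rewrite ltr0n; near: k; exact: nbhs_infty_gt.
have lb : (lne (v (k + K)%N) <= ((k + K)%:R * c)%:E)%E.
  have kK0 : (0 : R) < (k + K)%:R by rewrite natrD ltr_wpDr.
  have -> : lne (v (k + K)%N) = ((k + K)%:R%:E * b (k + K)%N)%E.
    by rewrite /b muleA -EFinM divff ?mul1e// gt_eqF.
  rewrite EFinM lee_pmul2l// ?lte_fin//.
  apply/ltW/Nb => /=; apply: leq_trans (leq_addr _ _).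
  by near: k; exact: nbhs_infty_ge.
have lu : (lne (u k) <= ((k + K)%:R * c)%:E)%E.
  apply: le_trans lb; rewrite lee_lne// in_itv/= leey andbT//.
  by rewrite (le_trans _ (v1 _)).
rewrite lE -EFinD (@le_trans _ _ ((k%:R^-1)%:E * ((k + K)%:R * c)%:E)%E)//.
  by rewrite lee_pmul2l// lte_fin invr_gt0.
rewrite -EFinM lee_fin mulrC ler_pdivrMr// natrD mulrDl.
have -> : (l + e) * k%:R = k%:R * c + e / 2 * k%:R.
  by rewrite /c [k%:R * _]mulrC -mulrDl -addrA -splitr.
(* What remains is that [K * c] is at most [e / 2 * k], which holds for large [k]. *)
rewrite lerD2l mulrC -ler_pdivrMl ?divr_gt0//.
by near: k; exact: nbhs_infty_ger.
Unshelve. all: by end_near. Qed.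

End GrowthRate.

(** * Compactness of the space of infinite orbits *)

Section CompactOrbitSpace.

(** Local equations exist also around a point [p] outside [Z]; one of them is nonzero at [p], hence
    near [p] by continuity. *)
Lemma analytic_subset_closed (R : realType) (n : nat) (M : complexManifold R n)
    (Z : set M) :
  analytic_subset Z -> closed Z.
Proof.
move=> Z_an; rewrite -openC openE => p Zp.
have [W [k [f [pW f_hol WZ]]]] := Z_an p.
have [[W_open Wp] [c Mc cp]] := (pW, manifold_cover p).
have [i fip] : exists i, f i p != 0.
  apply: contrapT => fp0; apply: Zp.
  suff : (W `&` Z) p by case.
  rewrite WZ; split=> // i; apply/eqP; apply: contrapT => /negP fip.
  by apply: fp0; exists i.
have fi_cont : {for p, continuous (f i)}.
  have fi_chart : {for chart_map c p, continuous (f i \o chart_inv c)}.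
    by apply: differentiable_continuous; exact: f_hol.
  have map_cont : {for p, continuous (chart_map c)}.
    by apply: chart_map_continuous; rewrite inE.
  have fi_comp := continuous_comp map_cont fi_chart.
  have inv_map q : chart_dom c q -> chart_inv c (chart_map c q) = q.
    by move=> cq; rewrite chart_mapK ?inE.
  (* [f i] factors through the chart only on the chart domain, so continuity is transferred by
     equality near [p]. *)
  rewrite /prop_for /continuous_at -[in X in _ --> X](inv_map p)//.
  apply: cvg_trans fi_comp; apply: near_eq_cvg.
  have : \forall q \near p, chart_dom c q.
    by apply: open_nbhs_nbhs; split=> //; exact: chart_dom_open.
  by apply: filterS => q cq /=; rewrite inv_map.
have fi_neq0 : \forall q \near p, f i q != 0.
  apply: (fi_cont [set x | x != 0]); apply: open_nbhs_nbhs; split=> //.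
  have -> : [set x : complexField R | x != 0] = ~` [set 0].
    by apply/seteqP; split=> x /= => [/eqP|x0]; last exact/eqP.
  apply: closed_openC; apply: accessible_closed_set1; apply: hausdorff_accessible.
  exact: norm_hausdorff.
near=> q => Zq.
have Wq : W q by near: q; exact: open_nbhs_nbhs.
have : (W `&` Z) q by [].
rewrite WZ => -[_ /(_ i) fq0].
have : f i q != 0 by near: q.
by rewrite fq0 eqxx.
Unshelve. all: by end_near. Qed.

(** The image filter under [set_val] contains [A], so it clusters at a point of [A]; open sets of
    the subtype are traces of open sets of [T]. *)
Lemma compact_set_type (T : topologicalType) (A : set T) :
  compact A -> compact [set: A].
Proof.
move=> A_compact F FF _.
have [|p [Ap pF]] := A_compact (set_val @ F) _.
  rewrite /fmap /=; suff -> : set_val @^-1` A = [set: A] by exact: filterT.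
  by apply/seteqP; split=> // o _; exact: set_valP.
exists (SigSub (mem_set Ap)); split=> // B V FB [_ [[U U_open <-] Up UV]].
have [||_ [[q Bq <-] Uq]] := pF (set_val @` B) U.
- by apply: (@filterS _ F _ B) => // q Bq; exists q.
- exact: open_nbhs_nbhs.
by exists q; split=> //; exact: UV.
Qed.

Lemma point_continuous (T U : topologicalType) (k : nat) :
  continuous (fun o : {ptws nat -> T} * {ptws nat -> U} => o.1 k).
Proof.
move=> o; apply: (@continuous_comp _ _ _ fst (fun x : {ptws nat -> T} => x k) o).
  exact: cvg_fst.
exact: (@proj_continuous _ (fun _ : nat => T) k).
Qed.

Lemma label_continuous (T U : topologicalType) (k : nat) :
  continuous (fun o : {ptws nat -> T} * {ptws nat -> U} => o.2 k).
Proof.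
move=> o; apply: (@continuous_comp _ _ _ snd (fun a : {ptws nat -> U} => a k) o).
  exact: cvg_snd.
exact: (@proj_continuous _ (fun _ : nat => U) k).
Qed.

Lemma infinite_orbits_closed (R : realType) (n : nat) (X : complexManifold R n)
    (G : holomorphic_correspondence X) :
  closed (infinite_orbits G).
Proof.
move=> o o_clos k.
have o1 j : (fun q : _ * _ => q.1 j) @ o --> o.1 j.
  exact: point_continuous.
(* Labels are discrete, so the [k]-th one is constant near [o], and the [k]-th condition concerns a
   single closed component. *)
have o2 : \forall q \near o, q.2 k = o.2 k.
  exact: (label_continuous (discrete_set1 _)).
have G_closed : closed (corr_comp G (tagnat.sig1 (o.2 k))).
  by have [/analytic_subset_closed] := corr_irreducible (tagnat.sig1 (o.2 k)).
apply: G_closed => B B_nbhs.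
have pB : \forall q \near o, B (q.1 k, q.1 k.+1).
  exact: (cvg_pair (o1 k) (o1 k.+1) B_nbhs).
have [q [qG [q2 Bq]]] := o_clos _ (filterI o2 pB).
exists (q.1 k, q.1 k.+1); split=> //; rewrite -q2; exact: qG.
Qed.

Lemma infinite_orbits_compact (R : realType) (n : nat) (X : complexManifold R n)
    (G : holomorphic_correspondence X) :
  compact [set: X] -> compact [set: infinite_orbits G].
Proof.
move=> X_compact; apply: compact_set_type.
apply: (subclosed_compact (@infinite_orbits_closed _ _ _ G) _ (subsetT _)).
have labels_compact : compact [set: discrete_topology 'I_(corr_total G)].
  by apply: finite_compact; exact: (@finite_finset 'I_(corr_total G)).
rewrite -setXTT; apply: compact_setX.
  have := @tychonoff nat (fun=> X : topologicalType) (fun=> setT) (fun=> X_compact).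
  by congr (compact _); apply/seteqP; split.
have := @tychonoff nat (fun=> discrete_topology 'I_(corr_total G))
  (fun=> setT) (fun=> labels_compact).
by congr (compact _); apply/seteqP; split.
Qed.

End CompactOrbitSpace.

(** * Compatible metrics and Lebesgue numbers *)

Section CompatibleMetric.
Variables (R : realType) (T : topologicalType) (d : T -> T -> R).
Hypothesis d_metric : compatible_metric d.

Lemma metric_xx x : d x x = 0.
Proof. exact/(metric_eq0 d_metric). Qed.

Lemma metric_ball_nbhs x (e : R) : 0 < e -> nbhs x [set y | d x y < e].
Proof. by move=> e0; apply/(metric_nbhs d_metric); exists e. Qed.

Lemma metric_lt_half (e : R) x y z : d x y < e / 2 -> d y z < e / 2 -> d x z < e.
Proof.
move=> xy yz; apply: le_lt_trans (metric_triangle_ineq d_metric _ y _) _.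
by rewrite [ltRHS]splitr ltrD.
Qed.

(** The Lebesgue number lemma, with the open cover replaced by a relation that holds on a
    neighbourhood of each diagonal point. *)
Lemma compact_lebesgue_number (E : T -> T -> Prop) :
  compact [set: T] ->
  (forall x : T, exists2 U : set T, nbhs x U & forall y z, U y -> U z -> E y z) ->
  exists2 r : R, 0 < r & forall y z, d y z < r -> E y z.
Proof.
move=> /compact_near_coveringP T_compact E_loc.
have [|r /= r0 rE] := T_compact R (0^'+) (fun r y => forall z, d y z < r -> E y z) _.
  move=> x _; have [U /(metric_nbhs d_metric)[r r0 rU] UE] := E_loc x.
  have r20 : 0 < r / 2 by rewrite divr_gt0.
  (* With [y] within [r / 2] of [x] and [z] within [s < r / 2] of [y], both lie in the [r]-ball
     around [x]. *)
  exists ([set y | d x y < r / 2], [set s | s < r / 2]) => /=.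
    by split; [exact: metric_ball_nbhs|exact: nbhs_right_lt].
  move=> [y s] /= [xy sr] z yz; apply: UE; apply: rU => /=.
    by rewrite (lt_trans xy)// ltr_pdivrMr// ltr_pMr// ltr1n.
  by apply: (metric_lt_half xy); exact: lt_trans sr.
(* The property holds for all radii strictly between 0 and [r]; [r / 2] is one of them. *)
exists (r / 2); first by rewrite divr_gt0.
move=> y z yz; apply: (rE (r / 2)) => //=; last by rewrite divr_gt0.
by rewrite sub0r normrN gtr0_norm ?divr_gt0// ltr_pdivrMr// ltr_pMr// ltr1n.
Qed.

(* Inference of the filter instances on this product type diverges. *)
Lemma coordinate_nbhs (L : choiceType) (k : nat)
    (o : {ptws nat -> T} * {ptws nat -> discrete_topology L}) (e : R) :
  0 < e -> nbhs o [set q | d (o.1 k) (q.1 k) < e /\ o.2 k = q.2 k].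
Proof.
move=> e0.
have point_o := @point_continuous _ (discrete_topology L) k o _
  (metric_ball_nbhs (o.1 k) e0).
have label_o := @label_continuous T _ k o _ (discrete_set1 (o.2 k)).
have := @filterI _ (nbhs o) (nbhs_filter o) _ _ point_o label_o.
by apply: (@filterS _ (nbhs o) (nbhs_filter o)) => q [].
Qed.

End CompatibleMetric.

(** * The metric [D] against coordinatewise closeness *)

Section OrbitSpaceMetric.
Variables (R : realType) (n : nat) (X : complexManifold R n).
Variable G : holomorphic_correspondence X.
Variables (d : X -> X -> R) (D : infinite_orbits G -> infinite_orbits G -> R).
Hypotheses (d_metric : compatible_metric d) (D_metric : compatible_metric D).
Hypothesis X_compact : compact [set: X].

Local Notation point o k := ((set_val (o : infinite_orbits G)).1 k).
Local Notation label o k := ((set_val (o : infinite_orbits G)).2 k).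

(** A basic entourage of the product uniformity; on the discrete labels closeness is equality. *)
Definition orbit_close (e : R) (K : nat) (o q : infinite_orbits G) : Prop :=
  forall k, (k <= K)%N -> d (point o k) (point q k) < e /\ label o k = label q k.

Lemma orbit_close_nbhs e K o : 0 < e -> nbhs o [set q | orbit_close e K o q].
Proof.
move=> e0.
have val_o : {for o, continuous (set_val : infinite_orbits G -> _)}.
  exact: initial_continuous.
have close_k k : \forall q \near o,
    d (point o k) (point q k) < e /\ label o k = label q k.
  exact: val_o (coordinate_nbhs d_metric k (set_val o) e0).
have : \forall q \near o, forall k : 'I_K.+1,
    d (point o k) (point q k) < e /\ label o k = label q k.
  exact: (@filter_forall _ _ (fun (k : 'I_K.+1) q =>
    d (point o k) (point q k) < e /\ label o k = label q k) (nbhs o) (nbhs_filter o) close_k).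
by apply: (@filterS _ (nbhs o) (nbhs_filter o)) => q oq k kK;
  exact: (oq (Ordinal (kK : (k < K.+1)%N))).
Qed.

(** The sets on the left decrease with [K] and generate a filter [F]. It converges to [o] in every
    coordinate, hence in the product topology. *)
Lemma nbhs_orbit_close o (A : set (infinite_orbits G)) :
  nbhs o A -> exists K : nat, [set q | orbit_close K.+1%:R^-1 K o q] `<=` A.
Proof.
pose F : set_system (infinite_orbits G) :=
  filter_from [set: nat] (fun K => [set q | orbit_close K.+1%:R^-1 K o q]).
have F_filter : Filter F.
  apply: filter_from_filter; first by exists 0%N.
  move=> K L _ _; exists (maxn K L) => // q oq.
  split=> k kK.
    have [oqk ->] := oq k (leq_trans kK (leq_maxl _ _)); split=> //.
    by apply: (lt_le_trans oqk); rewrite lef_pV2 ?posrE// ler_nat ltnS leq_maxl.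
  have [oqk ->] := oq k (leq_trans kK (leq_maxr _ _)); split=> //.
  by apply: (lt_le_trans oqk); rewrite lef_pV2 ?posrE// ler_nat ltnS leq_maxr.
have F_point k : (fun q => point q k) @ F --> point o k.
  move=> B /(metric_nbhs d_metric)[e e0 eB].
  have [N _ /(_ N (leqnn N)) Ne] := near_infty_natSinv_lt (PosNum e0).
  exists (maxn k N) => // q oq; apply: eB => /=.
  have [oqk _] := oq k (leq_maxl _ _).
  apply: lt_trans Ne; apply: (lt_le_trans oqk).
  by rewrite lef_pV2 ?posrE// ler_nat ltnS leq_maxr.
have F_label k : (fun q => label q k) @ F --> label o k.
  move=> B /nbhs_singleton Bo; exists k => // q oq.
  by have [_ oqk] := oq k (leqnn k); rewrite /= -oqk.
have F_val : (set_val : infinite_orbits G -> _) @ F --> set_val o.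
  apply: (@cvg_trans _ ((fun q => ((set_val q).1, (set_val q).2)) @ F)).
    by apply: near_eq_cvg; apply: nearW => q; case: (set_val q).
  case: (set_val o) F_point F_label => x a F_point F_label.
  apply: (@cvg_pair _ _ _ F (nbhs x) (nbhs a)); apply/cvg_sup =>
    k U [V [[W oW <-] /= Wo] WU].
    have FW : F [set q | W (point q k)].
      by apply: (F_point k W); exact: open_nbhs_nbhs.
    by apply: (@filterS _ F F_filter _ _ _ FW) => q Wq; exact: WU.
  have FW : F [set q | W (label q k)].
    by apply: (F_label k W); exact: open_nbhs_nbhs.
  by apply: (@filterS _ F F_filter _ _ _ FW) => q Wq; exact: WU.
move=> [_ [[U U_open <-] Uo] UA].
have [K _ KU] : F (set_val @^-1` U) by apply: F_val; exact: open_nbhs_nbhs.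
by exists K => q oq; apply: UA; exact: KU.
Qed.

Lemma metric_separated_shift (e : R) : 0 < e ->
  exists2 r : R, 0 < r & forall o q,
    e < d (point o 0%N) (point q 0%N) \/ label o 0%N <> label q 0%N -> r < D o q.
Proof.
move=> e0.
have [||r r0 rE] := compact_lebesgue_number D_metric (E := fun o q =>
    d (point o 0%N) (point q 0%N) < e /\ label o 0%N = label q 0%N).
- exact: infinite_orbits_compact.
- move=> o; exists [set q | orbit_close (e / 2) 0 o q].
    by apply: orbit_close_nbhs; rewrite divr_gt0.
  move=> p q /(_ 0%N isT)[op <-] /(_ 0%N isT)[oq <-]; split=> //.
  by apply: (metric_lt_half d_metric _ oq); rewrite (metric_symm d_metric).
(* Negating [D o q < r] gives only a weak inequality; halving makes it strict. *)
exists (r / 2); first by rewrite divr_gt0.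
move=> o q sep; rewrite ltNge; apply/negP => Doq.
have [|oq0 oq] := rE o q.
  by rewrite (le_lt_trans Doq)// ltr_pdivrMr// ltr_pMr// ltr1n.
by case: sep => // /lt_trans/(_ oq0); rewrite ltxx.
Qed.

Lemma metric_separated_prefix (e : R) : 0 < e ->
  exists K : nat, forall o q, e < D o q -> ~ orbit_close K.+1%:R^-1 K o q.
Proof.
move=> e0; have e20 : 0 < e / 2 by rewrite divr_gt0.
have /compact_near_coveringP Y_compact := infinite_orbits_compact (G := G) X_compact.
have [|N _ NE] := Y_compact nat \oo
    (fun K o => forall q, orbit_close K.+1%:R^-1 K o q -> D o q < e) _.
  move=> x _.
  have [K KD] := nbhs_orbit_close (metric_ball_nbhs D_metric x e20).
  have K20 : 0 < K.+1%:R^-1 / 2 :> R by rewrite divr_gt0.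
  (* If [p] is half-close to [x] and [q] is close to [p] at level [L], then [p] and [q] both lie in
     the [D]-ball of radius [e / 2] around [x]. *)
  exists ([set o | orbit_close (K.+1%:R^-1 / 2) K x o],
      [set L | (K <= L)%N /\ L.+1%:R^-1 < K.+1%:R^-1 / 2 :> R]) => /=.
    split; first exact: orbit_close_nbhs.
    by apply: filterI; [exact: nbhs_infty_ge|exact: near_infty_natSinv_lt (PosNum K20)].
  move=> [p L] /= [xp [KL Le]] q pq.
  have xq k : (k <= K)%N ->
      d (point x k) (point q k) < K.+1%:R^-1 /\ label x k = label q k.
    move=> kK; have [xpk ->] := xp k kK.
    have [pqk ->] := pq k (leq_trans kK KL); split=> //.
    by apply: (metric_lt_half d_metric xpk); exact: lt_trans Le.
  apply: (metric_lt_half D_metric (y := x)); last exact: KD.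
  rewrite (metric_symm D_metric); apply: KD => k kK.
  have [xpk ->] := xp k kK; split=> //; apply: (lt_trans xpk).
  by rewrite ltr_pdivrMr// ltr_pMr// ltr1n.
exists N => o q eD /(NE N (leqnn N) o I) /lt_trans/(_ eD).
by rewrite ltxx.
Qed.

End OrbitSpaceMetric.

(** * Extension of finite orbits to infinite ones *)

Section OrbitExtension.
Variables (R : realType) (n : nat) (X : complexManifold R n).
Variable G : holomorphic_correspondence X.

Lemma corr_total_gt0 : (0 < corr_total G)%N.
Proof.
rewrite /corr_total (bigD1 (Ordinal (corr_size_gt0 G)))//=.
by rewrite ltn_addr// corr_mult_gt0.
Qed.

(** The first projection of any one component is surjective, so a single label provides a successor
    for every point. *)
Lemma corr_successor : exists (a : 'I_(corr_total G)) (s : X -> X),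
  forall x, corr_listed a (x, s x).
Proof.
pose a := Ordinal corr_total_gt0; exists a.
have a_surj x : exists y, corr_listed a (x, y).
  have : [set: X] x by [].
  by rewrite -(corr_fst_surj (tagnat.sig1 a)) => -[[y z] /= ayz <-]; exists z.
by have [s sP] := choice a_surj; exists s.
Qed.

Lemma finite_orbit_extension nu
    (o : {ffun 'I_nu.+1 -> X} * {ffun 'I_nu -> 'I_(corr_total G)}) :
  finite_orbits o -> exists q : infinite_orbits G,
    (forall k : 'I_nu.+1, (set_val q).1 k = o.1 k) /\
    (forall k : 'I_nu, (set_val q).2 k = o.2 k).
Proof.
move=> oG; have [a [s sP]] := corr_successor.
(* The orbit is continued from its last point by iterating [s], always with label [a]; time [nu]
   falls in the second branch, with zero iterations. *)
pose x k := if (k < nu)%N then o.1 (inord k) else iter (k - nu) s (o.1 ord_max).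
pose b k := if insub k is Some i then o.2 i else a.
have x_ge k : (nu <= k)%N -> x k = iter (k - nu) s (o.1 ord_max).
  by rewrite /x leqNgt => /negbTE ->.
have xE (k : 'I_nu.+1) : x k = o.1 k.
  rewrite /x; case: ltnP => [_|nuk]; first by rewrite inord_val.
  have -> : k = ord_max by apply/val_inj/eqP; rewrite /= eqn_leq nuk -ltnS ltn_ord.
  by rewrite subnn.
have bE (k : 'I_nu) : b k = o.2 k by rewrite /b valK.
have xbG : infinite_orbits G (x, b).
  move=> k /=; have [knu|nuk] := ltnP k nu.
    have := oG (Ordinal knu); rewrite -bE -!xE.
    by congr (corr_listed _ (_, x _)).
  rewrite /b insubF; last by rewrite ltnNge nuk.
  by rewrite !x_ge ?leqW// subSn//= ; exact: sP.
by exists (SigSub (mem_set xbG)).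
Qed.

(** An irreducible component is nonempty and so yields a point of [X], which is a 0-orbit to
    extend. *)
Lemma infinite_orbits_nonempty : [set: infinite_orbits G] !=set0.
Proof.
have [_ [[x y] _] _] := corr_irreducible (Ordinal (corr_size_gt0 G)).
have [|q _] := @finite_orbit_extension 0 ([ffun=> x], [ffun=> Ordinal corr_total_gt0]).
  by case.
by exists q.
Qed.

Lemma iter_shift_fun (q : infinite_orbits G) j :
  set_val (iter j (@shift_fun _ _ _ G) q) =
  (fun k => (set_val q).1 (k + j)%N, fun k => (set_val q).2 (k + j)%N).
Proof.
have set_val_shift p : set_val (shift_fun p) = shift_pair (set_val p) by [].
elim: j => [|j IH].
  by rewrite /= [LHS]surjective_pairing; congr pair; apply/funext => k; rewrite addn0.
rewrite iterS set_val_shift IH /shift_pair /=.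
by congr pair; apply/funext => k; rewrite addnS addSn.
Qed.

End OrbitExtension.

(** * The two entropy inequalities *)

Lemma le_entropy_rate (R : realType) (N M : R -> nat -> \bar R) :
  (forall e k, 1 <= N e k)%E -> (forall e k, 1 <= M e k)%E ->
  (forall e, 0 < e -> exists2 r, 0 < r &
    exists K, forall k, (N e k <= M r (k + K)%N)%E) ->
  (entropy_rate N <= entropy_rate M)%E.
Proof.
move=> N1 M1 NM; apply: ge_ereal_sup => _ [e /= e0 <-].
(* [r] and [K] depend on [e] alone, so the limsups can be compared at fixed scales. *)
have [r r0 [K NMK]] := NM _ e0.
apply: (@le_trans _ _ (limn_esup (fun k => (k%:R^-1)%:E * lne (M r k))%E)).
  by apply: (limn_esup_rate_shift (K := K)) => // k; exact: le_trans (N1 _ _).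
by apply: ereal_sup_ubound; exists r.
Qed.

Section EntropyComparison.
Variables (R : realType) (n : nat) (X : complexManifold R n).
Hypothesis X_compact : compact [set: X].
Variable G : holomorphic_correspondence X.
Variables (d : X -> X -> R) (D : infinite_orbits G -> infinite_orbits G -> R).
Hypotheses (d_metric : compatible_metric d) (D_metric : compatible_metric D).

Let prefix nu (q : infinite_orbits G) :
    {ffun 'I_nu.+1 -> X} * {ffun 'I_nu -> 'I_(corr_total G)} :=
  ([ffun k : 'I_nu.+1 => (set_val q).1 k], [ffun k : 'I_nu => (set_val q).2 k]).

Let prefix_orbit nu q : finite_orbits (prefix nu q).
Proof. by move=> k; rewrite /= !ffunE; exact: (set_valP q k). Qed.

Let segment nu (q : infinite_orbits G) : {ffun 'I_nu.+1 -> infinite_orbits G} :=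
  [ffun k : 'I_nu.+1 => iter k (orbit_shift G) q].

Let segment_orbit nu q : orbit_segments (orbit_shift G) (segment nu q).
Proof. by exists q. Qed.

Let corr_separated_ge1 e nu :
  (1 <= max_separated R (@finite_orbits _ _ _ G nu)
          (@orbit_separated _ _ _ G d e nu))%E.
Proof.
have [q _] := infinite_orbits_nonempty G.
exact: (@max_separated_ge1 R _ _ _ _ (@prefix_orbit nu q)).
Qed.

Let bowen_separated_ge1 e nu :
  (1 <= max_separated R (@orbit_segments _ (orbit_shift G) nu)
          (@bowen_separated _ _ D e nu))%E.
Proof.
have [q _] := infinite_orbits_nonempty G.
exact: (@max_separated_ge1 R _ _ _ _ (@segment_orbit nu q)).
Qed.

Lemma corr_entropy_le_bowen : (corr_entropy G d <= bowen_entropy D (orbit_shift G))%E.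
Proof.
apply: le_entropy_rate => // e e0.
have [r r0 rP] := metric_separated_shift d_metric D_metric X_compact e0.
exists r => //; exists 0%N => nu; rewrite addn0.
have [q0 _] := infinite_orbits_nonempty G.
(* Choice needs a total function; tuples that are not orbits are sent to [q0]. *)
have ext_ex (o : {ffun 'I_nu.+1 -> X} * {ffun 'I_nu -> 'I_(corr_total G)}) :
    exists q : infinite_orbits G, finite_orbits o ->
    (forall k : 'I_nu.+1, (set_val q).1 k = o.1 k) /\
    (forall k : 'I_nu, (set_val q).2 k = o.2 k).
  have [/finite_orbit_extension[q qo]|oG] := pselect (finite_orbits o).
    by exists q.
  by exists q0.
have [ext extP] := choice ext_ex.
apply: (@max_separated_le R _ _ _ _ _ _ (fun o => segment nu (ext o)))
  => [p _|o o' oG oG' sep|u [k]].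
- exact: segment_orbit.
- have [[ext1 ext2] [ext1' ext2']] := (extP o oG, extP o' oG').
  (* A difference at time [k], in point or label, is at time 0 after [k] shifts. *)
  case: sep => -[k sepk].
    exists k; rewrite !ffunE; apply: rP; left.
    by rewrite !iter_shift_fun /= !add0n ext1 ext1'.
  exists (widen_ord (leqnSn nu) k); rewrite !ffunE; apply: rP; right.
  by rewrite !iter_shift_fun /= !add0n ext2 ext2'.
- by rewrite metric_xx// ltNge ltW.
Qed.

Lemma bowen_entropy_le_corr : (bowen_entropy D (orbit_shift G) <= corr_entropy G d)%E.
Proof.
apply: le_entropy_rate => // e e0.
have [K KP] := metric_separated_prefix d_metric D_metric X_compact e0.
(* Failure of closeness gives only a weak inequality, while separation is strict; hence the half. *)
exists (K.+1%:R^-1 / 2); first by rewrite divr_gt0.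
(* Closeness after [k <= nu] shifts involves labels with index up to [nu + K], that is [nu + K + 1]
   labels. *)
exists K.+1 => nu; rewrite addnS.
apply: (@max_separated_le R _ _ _ _ _ _ 
    (fun s : {ffun 'I_nu.+1 -> infinite_orbits G} => prefix (nu + K).+1 (s ord0)))
  => [s _|_ _ [q _ <-] [q' _ <-] [k]|u [[k]|[k]]].
- exact: prefix_orbit.
(* If the prefixes were not separated, the [k]-th shifts would be close in coordinates 0 to [K]. *)
- rewrite !ffunE /= => /KP qq'; apply: contrapT => nsep; apply: qq' => j jK.
  rewrite !iter_shift_fun /=.
  have jk : (j + k < (nu + K).+1)%N.
    by rewrite ltnS addnC leq_add// -ltnS ltn_ord.
  split; last first.
    apply: contrapT => qq'; apply: nsep; right; exists (Ordinal jk).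
    by rewrite !ffunE.
  have jk1 := ltnW jk : (j + k < (nu + K).+2)%N.
  rewrite ltNge; apply/negP => qq'; apply: nsep; left; exists (Ordinal jk1).
  rewrite !ffunE /=; apply: lt_le_trans qq'.
  by rewrite ltr_pdivrMr// ltr_pMr// ltr1n.
- by rewrite metric_xx// ltNge divr_ge0.
- by [].
Qed.

End EntropyComparison.

Theorem proposition3p5 (R : realType) (n : nat) (X : complexManifold R n)
    (X_compact : compact [set: X]) (X_connected : connected [set: X])
    (G : holomorphic_correspondence X)
    (d : X -> X -> R) (d_metric : compatible_metric d)
    (D : infinite_orbits G -> infinite_orbits G -> R)
    (D_metric : compatible_metric D) :
  corr_entropy G d = bowen_entropy D (orbit_shift G).
Proof.
apply/le_anti/andP; split; first exact: corr_entropy_le_bowen.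
exact: bowen_entropy_le_corr.
Qed.
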